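(* Let $p,n\in\mathbb N$ with $p\ge n\ge 15$, and write $p=k(n-1)+r$ with $k\in\mathbb N$ and $r\in\{3,4,\ldots,n-9\}$. Then $$\mathrm{ex}(p;T_n^3)=\frac{(n-2)p-r(n-1-r)}2+\max\Big\{0,\Big\lfloor\frac{r(n-4-r)-3(n-1)}2\Big\rfloor\Big\}.$$
   Context: All graphs are finite simple graphs. For a graph $L$, $\mathrm{ex}(p;L)$ denotes the maximum number of edges in a graph on $p$ vertices that contains no subgraph isomorphic to $L$. For $n\ge 6$, $T_n^3$ is the tree on vertex set $\{v_0,\ldots,v_{n-1}\}$ with edge set $\{v_0v_1,v_0v_2,\ldots,v_0v_{n-4},\ v_1v_{n-3},\ v_1v_{n-2},\ v_1v_{n-1}\}$. $\lfloor x\rfloor$ is the greatest integer not exceeding $x$; $\mathbb N=\{1,2,\ldots\}$. *)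

(* Defs.v *)
From HB Require Import structures.
From mathcomp Require Import all_boot all_order all_algebra.
Set Implicit Arguments. Unset Strict Implicit. Unset Printing Implicit Defensive.

Definition simple_graph (p : nat) (E : {set {set 'I_p}}) : bool :=
  [forall e in E, #|e| == 2].

Definition contains_sub (n p : nat) (L : rel 'I_n) (E : {set {set 'I_p}}) : bool :=
  [exists f : {ffun 'I_n -> 'I_p},
     injectiveb f && [forall i, forall j, L i j ==> ([set f i; f j] \in E)]].

(* ex(p;L): maximum number of edges of a simple graph on p vertices with no
   subgraph isomorphic to L (the empty graph always qualifies if L has an edge). *)
Definition ex (n p : nat) (L : rel 'I_n) : nat :=
  \max_(E : {set {set 'I_p}} | simple_graph E && ~~ contains_sub L E) #|E|.

Definition T3edge (n : nat) (i j : 'I_n) : bool :=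
  ((i == 0 :> nat) && (1 <= j <= n - 4)) || ((i == 1 :> nat) && (n - 3 <= j)).

Definition Tn3 (n : nat) : rel 'I_n := fun i j => T3edge i j || T3edge j i.
Arguments Tn3 n : clear implicits.
Arguments ex {n} p L.

(* Main.v *)
(** Upper bound.  In a T_n^3-free graph, an edge vu with d(v) >= n-4 and d(u) >= 4
    satisfies |N(v) U N(u)| <= n-1: otherwise T_n^3 embeds with v, u as v_0, v_1.
    Induct on k: whenever some set of n-1 vertices meets at most C(n-1,2) edges,
    delete it.  Let v have maximum degree D and let C = N[v].
    If D >= n-1, all neighbours of v have degree at most 3, so delete n-1 of them.
    If D = n-2, delete C.  If D = n-3, delete C and one vertex, namely a neighbour
    outside C of some u in C with d(u) = n-3, if there is one.  If D = n-4 and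
    k >= 2, the degree sum is at most (n-4)p, which is small enough; if k = 1,
    either some u in C with d(u) = n-4 has a neighbour x outside C, and C, x and
    any other vertex are deleted, or C sends out so few edges that counting
    C and its complement separately suffices.  If D <= n-5, use D p.

    Lower bound.  Take either k K_{n-1} + K_r, or (k-1) K_{n-1} plus a graph on
    n-1+r vertices with all degrees n-5, up to one vertex of degree n-6. *)
Require Import Defs.
From HB Require Import structures.
From mathcomp Require Import all_boot all_order all_algebra.
From mathcomp Require Import zify.
Import Order.TTheory GRing.Theory Num.Theory.
Set Implicit Arguments. Unset Strict Implicit. Unset Printing Implicit Defensive.

(** * Edge sets, and embedding the tree around an edge *)

Lemma sum_degrees_edges (p : nat) (E : {set {set 'I_p}}) : simple_graph E ->
  \sum_i #|[set j | [set i; j] \in E]| = #|E|.*2.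
Proof.
move=> /forall_inP simE.
have neq i j : [set i; j] \in E -> i != j.
  by move=> /simE; rewrite cards2; case: (i != j).
have star i : #|[set j | [set i; j] \in E]| = \sum_(A in E) (i \in A).
  rewrite -(card_in_imset (f := fun j => [set i; j])); last first.
    move=> j j'; rewrite !inE => Ej Ej' /setP /(_ j).
    rewrite !inE eqxx orbT => /esym/predU1P [ji|/eqP //].
    by have := neq _ _ Ej; rewrite ji eqxx.
  transitivity #|[set A in E | i \in A]|.
    apply: eq_card => A; rewrite inE; apply/imsetP/andP => [[j]|[AE iA]].
      by rewrite inE => Ej ->; rewrite Ej !inE eqxx.
    have := simE _ AE; rewrite (cardsD1 i) iA => /cards1P [j Aj].
    by exists j; [rewrite inE -Aj setD1K|rewrite -Aj setD1K].
  rewrite -sum1_card [LHS]big_mkcond [RHS]big_mkcond /=.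
  by apply: eq_bigr => A _; rewrite inE; case: (A \in E); case: (i \in A).
rewrite (eq_bigr _ (fun i _ => star i)) exchange_big /=.
rewrite -mul2n mulnC -sum_nat_const; apply: eq_bigr => A /simE /eqP <-.
by rewrite -sum1_card [RHS]big_mkcond; apply: eq_bigr => i _; case: (i \in A).
Qed.

Lemma subset_between (T : finType) (X Y : {set T}) (m : nat) :
  X \subset Y -> #|X| <= m <= #|Y| ->
  exists B : {set T}, [/\ X \subset B, B \subset Y & #|B| = m].
Proof.
move=> sXY /andP [leXm]; elim: m leXm => [|m IHm] leXm lemY.
  by exists X; split=> //; apply/eqP; rewrite -leqn0.
move: leXm; rewrite leq_eqVlt => /predU1P [<-|/IHm]; first by exists X.
case=> [|B [sXB sBY cB]]; first exact: ltnW.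
have [|[y]] := set_0Vmem (Y :\: B).
  by move/eqP; rewrite setD_eq0 => /subset_leq_card; rewrite cB leqNgt lemY.
rewrite inE => /andP [yB yY]; exists (y |: B); split.
- exact: subset_trans sXB (subsetUr _ _).
- by rewrite subUset sub1set yY.
- by rewrite cardsU1 yB cB.
Qed.

(** The images of v_0, ..., v_{n-1} are listed in order: [v] and [u] are the two centres, [A] fills
    positions 2 to n-4 (the leaves of v_0), and [B] fills the last three (the leaves of v_1). *)
Lemma contains_Tn3 (n p : nat) (E : {set {set 'I_p}}) (v u : 'I_p)
    (A B : {set 'I_p}) :
  6 <= n -> [set v; u] \in E ->
  {in A, forall w, [set v; w] \in E} -> {in B, forall w, [set u; w] \in E} ->
  [disjoint A & B] -> v != u -> v \notin A :|: B -> u \notin A :|: B ->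
  #|A| = n - 5 -> #|B| = 3 -> contains_sub (Tn3 n) E.
Proof.
move=> n6 vu EA EB dAB neq_vu vAB uAB cA cB.
pose s := [:: v, u & enum A ++ enum B].
have size_s : size s = n by rewrite /= size_cat -!cardE cA cB; lia.
have uniq_s : uniq s.
  rewrite /= inE !mem_cat !mem_enum cat_uniq !enum_uniq (negPf neq_vu) /= andbT.
  move: vAB uAB; rewrite !inE => -> -> /=; apply/hasPn => w /=.
  by rewrite !mem_enum => wB; rewrite (disjointFl dAB wB).
have nthA i : 2 <= i < n - 3 -> nth v s i \in A.
  case: i => [|[|i]] //= i_lt; rewrite nth_cat -cardE ifT ?cA; last lia.
  by rewrite -mem_enum mem_nth // -cardE cA; lia.
have nthB i : n - 3 <= i < n -> nth v s i \in B.
  move=> i_bd; have [j def_i] : exists j, i = j.+2 by exists i.-2; lia.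
  rewrite {}def_i /= in i_bd *; rewrite nth_cat -cardE ifF ?cA; last lia.
  by rewrite -mem_enum mem_nth // -cardE cB; lia.
have edge (i j : 'I_n) : T3edge i j -> [set nth v s i; nth v s j] \in E.
  case/orP => [/andP [/eqP -> /andP [j1 j2]]|/andP [/eqP -> j3]].
    have [->|j_ne1] := eqVneq (j : nat) 1; first by [].
    by apply/EA/nthA; lia.
  by apply/EB/nthB; rewrite j3 /=.
apply/existsP; exists [ffun i : 'I_n => nth v s i]; apply/andP; split.
  apply/injectiveP => i j; rewrite !ffunE => /eqP.
  by rewrite nth_uniq ?size_s // => /eqP /val_inj.
apply/forallP => i; apply/forallP => j; apply/implyP; rewrite !ffunE.
by case/orP => /edge //; rewrite setUC.
Qed.

(** The leaves of [v] are sought in [Q], its neighbours other than [u], and the three leaves of [u]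
    in [P], its neighbours other than [v]. A union of at least n vertices leaves at least n-2 in
    [P :|: Q], which is room for disjoint choices. *)
Lemma union_nbr_Tn3_free (n p : nat) (E : {set {set 'I_p}}) (v u : 'I_p) :
  6 <= n -> simple_graph E -> ~~ contains_sub (Tn3 n) E -> [set v; u] \in E ->
  n - 4 <= #|[set w | [set v; w] \in E]| -> 4 <= #|[set w | [set u; w] \in E]| ->
  #|[set w | [set v; w] \in E] :|: [set w | [set u; w] \in E]| <= n - 1.
Proof.
move=> n_ge6 /forall_inP simE free vu dv du.
have neq i j : [set i; j] \in E -> i != j.
  by move=> /simE; rewrite cards2; case: (i != j).
rewrite leqNgt; apply: contra free => big.
have neq_vu := neq _ _ vu.
move def_Nv: [set w | [set v; w] \in E] => Nv in dv big.
move def_Nu: [set w | [set u; w] \in E] => Nu in du big.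
have inNv w : (w \in Nv) = ([set v; w] \in E) by rewrite -def_Nv inE.
have inNu w : (w \in Nu) = ([set u; w] \in E) by rewrite -def_Nu inE.
have uNv : u \in Nv by rewrite inNv.
have vNu : v \in Nu by rewrite inNu setUC.
have vNv : v \in Nv = false by apply/negP; rewrite inNv => /neq; rewrite eqxx.
have uNu : u \in Nu = false by apply/negP; rewrite inNu => /neq; rewrite eqxx.
pose P := Nu :\ v; pose Q := Nv :\ u.
have cP : 3 <= #|P| by move: du; rewrite (cardsD1 v) vNu.
have cQ : n - 5 <= #|Q| by move: dv; rewrite (cardsD1 u) uNv -/Q; lia.
have cPQ : n - 2 <= #|P :|: Q|.
  have -> : P :|: Q = (Nv :|: Nu) :\ v :\ u.
    apply/setP => w; rewrite !inE.
    case: (eqVneq w u) => [->|_] /=; first by rewrite uNu andbF.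
    by case: (eqVneq w v) => [->|] //=; rewrite orbC.
  move: big; rewrite (cardsD1 v) !inE vNu orbT (cardsD1 u (_ :\ v)) !inE uNv.
  by rewrite eq_sym neq_vu /=; lia.
(* If [P :\: Q] has three elements, [B] is taken there and costs [Q] nothing. Otherwise [B] includes
   all of [P :\: Q], so [Q] and [B] together cover [P :|: Q], and [Q :\: B] keeps at least (n-2) - 3
   = n-5 elements. *)
have [B [sBP cB cQB]] : exists B : {set 'I_p},
    [/\ B \subset P, #|B| = 3 & n - 5 <= #|Q :\: B|].
  have [PQ3|PQ3] := leqP 3 #|P :\: Q|.
    have [|B [_ sB cB]] := @subset_between _ set0 (P :\: Q) 3 (sub0set _).
      by rewrite cards0.
    exists B; split=> //; first exact: subset_trans sB (subsetDl _ _).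
    by move: sB; rewrite subsetD => /andP [_ dBQ]; rewrite (setDidPl _) // disjoint_sym.
  have [|B [sPQB sB cB]] := @subset_between _ (P :\: Q) P 3 (subsetDl _ _).
    by rewrite cP (ltnW PQ3).
  exists B; split=> //.
  have : P :|: Q \subset (Q :\: B) :|: B.
    apply/subsetP => w wPQ; rewrite in_setU in_setD.
    case: (boolP (w \in B)) => [|wB]; first by rewrite orbT.
    rewrite orbF /=; case: (boolP (w \in Q)) => // wQ.
    have/(subsetP sPQB) : w \in P :\: Q.
      by move: wPQ; rewrite in_setD wQ in_setU (negPf wQ) orbF.
    by rewrite (negPf wB).
  move=> /subset_leq_card; have := (leq_card_setU (Q :\: B) B).1.
  by rewrite cB; lia.
have [|A [_ sA cA]] := @subset_between _ set0 (Q :\: B) (n - 5) (sub0set _).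
  by rewrite cards0.
apply: (@contains_Tn3 _ _ _ v u A B) => // [w /(subsetP sA)|w /(subsetP sBP)|||].
- by rewrite !inE inNv => /and3P [].
- by rewrite !inE inNu => /andP [].
- by move: sA; rewrite subsetD => /andP [].
- rewrite inE negb_or; apply/andP; split; apply/negP.
    by move/(subsetP sA); rewrite !inE vNv !andbF.
  by move/(subsetP sBP); rewrite !inE eqxx.
- rewrite inE negb_or; apply/andP; split; apply/negP.
    by move/(subsetP sA); rewrite !inE eqxx !andbF.
  by move/(subsetP sBP); rewrite !inE uNu andbF.
Qed.

(** * Degree sums over vertex subsets, and the effect of deleting vertices *)

Definition nbr_in (T : finType) (e : rel T) (V : {set T}) (v : T) : {set T} :=
  [set w in V | e v w].

(** Twice the number of edges of the subgraph induced on [V]; all edge bounds are kept in this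
    doubled form. *)
Definition degree_sum (T : finType) (e : rel T) (V : {set T}) : nat :=
  \sum_(u in V) #|nbr_in e V u|.

Lemma degree_sumT (T : finType) (e : rel T) :
  degree_sum e setT = \sum_u #|nbr_in e setT u|.
Proof. by apply: eq_bigl => u; rewrite inE. Qed.

Lemma card_nbr_in_le (T : finType) (e : rel T) (V : {set T}) (v : T) :
  irreflexive e -> v \in V -> #|nbr_in e V v| <= #|V| - 1.
Proof.
move=> irr vV; rewrite (cardsD1 v V) vV add1n subn1 subset_leq_card //.
apply/subsetP => w; rewrite !inE => /andP [wV vw]; rewrite wV andbT.
by apply: contraTneq vw => ->; rewrite irr.
Qed.

Lemma degree_sum_le (T : finType) (e : rel T) (V : {set T}) (d : nat) :
  (forall v, v \in V -> #|nbr_in e V v| <= d) -> degree_sum e V <= #|V| * d.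
Proof. by move=> deg; rewrite -sum_nat_const leq_sum. Qed.

(** The sum over [S] is twice the number of edges meeting [S]: an edge inside [S] is counted from
    both ends, and an edge leaving [S] once as part of a degree and once by the second summand. *)
Lemma degree_sumD (T : finType) (e : rel T) (V S : {set T}) :
  symmetric e -> S \subset V ->
  degree_sum e V = degree_sum e (V :\: S)
    + \sum_(u in S) (#|nbr_in e V u| + #|nbr_in e V u :\: S|).
Proof.
move=> sym sSV.
have cross : \sum_(u in V :\: S) #|nbr_in e V u :&: S|
           = \sum_(u in S) #|nbr_in e V u :\: S|.
  transitivity (\sum_(u in V :\: S) \sum_(w in S) (e u w : nat)).
    apply: eq_bigr => u uV; rewrite -sum1_card big_mkcond [RHS]big_mkcond.
    apply: eq_bigr => w _; rewrite !inE; case: (boolP (w \in S)) => wS.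
      by rewrite (subsetP sSV) // andbT; case: (e u w).
    by rewrite andbF.
  rewrite exchange_big /=; apply: eq_bigr => u uS.
  rewrite -sum1_card big_mkcond [RHS]big_mkcond.
  apply: eq_bigr => w _; rewrite !inE sym.
  by case: (w \in S); case: (w \in V); case: (e u w).
rewrite {1}/degree_sum (big_setID S) /= (setIidPr sSV) big_split /= -cross.
rewrite [RHS]addnCA; congr addn; rewrite -big_split /=; apply: eq_bigr => u _.
rewrite -(cardsID S (nbr_in e V u)) addnC; congr addn.
by apply: eq_card => w; rewrite !inE andbA.
Qed.

Lemma degree_sumD1 (T : finType) (e : rel T) (V : {set T}) (x : T) :
  symmetric e -> irreflexive e -> x \in V ->
  degree_sum e V = degree_sum e (V :\ x) + 2 * #|nbr_in e V x|.
Proof.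
move=> sym irr xV; rewrite (@degree_sumD _ _ V [set x]) ?sub1set // big_set1.
congr addn; rewrite mul2n -addnn; congr addn.
apply: eq_card => w; rewrite !inE.
by case: eqP => // ->; rewrite irr andbF.
Qed.

Lemma nbr_inD (T : finType) (e : rel T) (V S : {set T}) (x : T) :
  nbr_in e (V :\: S) x = nbr_in e V x :\: S.
Proof. by apply/setP => w; rewrite !inE andbA. Qed.

(* Quantifying over the vertex subset V makes the property hereditary. *)
Definition small_unions (T : finType) (e : rel T) (n : nat) : Prop :=
  forall (V : {set T}) v u, u \in nbr_in e V v ->
    n - 4 <= #|nbr_in e V v| -> 4 <= #|nbr_in e V u| ->
    #|nbr_in e V v :|: nbr_in e V u| <= n - 1.

(** Since [v] is itself a neighbour of [u], the union of the two neighbourhoods contains the whole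
    closed neighbourhood of [v], and the neighbours of [u] outside it are extra. *)
Lemma card_out_le (T : finType) (e : rel T) (n : nat) (V : {set T}) (v u : T) :
  symmetric e -> small_unions e n -> v \in V -> u \in nbr_in e V v ->
  n - 4 <= #|nbr_in e V v| -> 4 <= #|nbr_in e V u| ->
  #|nbr_in e V u :\: (v |: nbr_in e V v)| + #|v |: nbr_in e V v| <= n - 1.
Proof.
move=> sym small vV uv dv du; apply: leq_trans (small V v u uv dv du).
rewrite addnC -(cardsID (v |: nbr_in e V v) (_ V v :|: _ V u)).
apply: leq_add; apply: subset_leq_card.
  rewrite subsetI subxx andbT subUset subsetUl sub1set andbT !inE vV sym.
  by move: uv; rewrite inE => /andP [_ ->]; rewrite orbT.
by apply: setSD; apply: subsetUr.
Qed.

(** * Deleting n-1 vertices, by the value of the maximum degree *)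

(** The number (n-1)(n-2) is the degree sum of K_{n-1}, so the deleted set costs no more than one
    clique of the extremal graph. *)
Definition peelable (T : finType) (e : rel T) (n : nat) (V : {set T}) : Prop :=
  exists S : {set T}, [/\ S \subset V, #|S| = n - 1 &
    degree_sum e V <= degree_sum e (V :\: S) + (n - 1) * (n - 2)].

(** One of the at most three neighbours of [u] is [v]. *)
Lemma card_out_le2 (T : finType) (e : rel T) (V : {set T}) (v u : T) :
  symmetric e -> v \in V -> u \in nbr_in e V v -> #|nbr_in e V u| <= 3 ->
  #|nbr_in e V u :\: (v |: nbr_in e V v)| <= 2.
Proof.
move=> sym vV; rewrite inE => /andP [uV vu].
rewrite (cardsD1 v) inE vV sym vu add1n ltnS; apply: leq_trans.
by apply: subset_leq_card; rewrite setDUr subsetIl.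
Qed.

Lemma card_closed_nbr (T : finType) (e : rel T) (V : {set T}) (v : T) :
  irreflexive e -> #|v |: nbr_in e V v| = #|nbr_in e V v|.+1.
Proof. by move=> irr; rewrite cardsU1 inE irr andbF. Qed.

Lemma peelable_big_degree (T : finType) (e : rel T) (n : nat) (V : {set T}) v :
  8 <= n -> symmetric e -> irreflexive e -> small_unions e n -> v \in V ->
  n - 1 <= #|nbr_in e V v| -> peelable e n V.
Proof.
move=> n8 sym irr small vV dv.
have low u : u \in nbr_in e V v -> #|nbr_in e V u| <= 3.
  move=> uv; rewrite leqNgt; apply/negP => du.
  have := card_out_le sym small vV uv _ du.
  by rewrite card_closed_nbr //; lia.
have [|S [_ sS cS]] := @subset_between _ set0 (nbr_in e V v) (n - 1) (sub0set _).
  by rewrite cards0.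
have sSV : S \subset V by apply: subset_trans sS _; apply/subsetP => w /setIdP [].
exists S; split=> //; rewrite (degree_sumD sym sSV) leq_add2l -cS -sum_nat_const.
(* Each deleted vertex contributes at most 3 + 3 = 6, which is at most n-2. *)
apply: leq_sum => u /(subsetP sS) /low du.
have := subset_leq_card (subsetDl (nbr_in e V u) S); lia.
Qed.

(** The closed neighbourhood of [v] already has n-1 vertices, so its members of degree at least 4
    have no neighbour outside; the others contribute at most 3 + 2 = 5. *)
Lemma peelable_degree_n2 (T : finType) (e : rel T) (n : nat) (V : {set T}) v :
  8 <= n -> symmetric e -> irreflexive e -> small_unions e n -> v \in V ->
  #|nbr_in e V v| = n - 2 ->
  (forall u, u \in V -> #|nbr_in e V u| <= n - 2) -> peelable e n V.
Proof.
move=> n8 sym irr small vV dv max.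
have cC := card_closed_nbr V v irr.
have sC : v |: nbr_in e V v \subset V.
  by rewrite subUset sub1set vV; apply/subsetP => w /setIdP [].
exists (v |: nbr_in e V v); split=> //; first by lia.
rewrite (degree_sumD sym sC) leq_add2l.
have -> : n - 1 = #|v |: nbr_in e V v| by lia.
rewrite -sum_nat_const; apply: leq_sum => u uC; have uV := subsetP sC _ uC.
have [->|uv] := eqVneq u v.
  by rewrite setDUr setDv setI0 cards0 dv addn0.
move: uC; rewrite in_setU1 (negPf uv) /= => uC; have := max _ uV.
have [du|du] := leqP 4 #|nbr_in e V u|.
  by have := card_out_le sym small vV uC _ du; lia.
by have := card_out_le2 sym vV uC du; lia.
Qed.

Lemma peelable_degree_n3 (T : finType) (e : rel T) (n : nat) (V : {set T}) v :
  9 <= n <= #|V| -> symmetric e -> irreflexive e -> small_unions e n -> v \in V ->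
  #|nbr_in e V v| = n - 3 ->
  (forall u, u \in V -> #|nbr_in e V u| <= n - 3) -> peelable e n V.
Proof.
move=> /andP [n9 nV] sym irr small vV dv max.
move def_C: (v |: nbr_in e V v) => C.
have cC : #|C| = n - 2 by rewrite -def_C card_closed_nbr // dv; lia.
have sC : C \subset V.
  by rewrite -def_C subUset sub1set vV; apply/subsetP => w /setIdP [].
have outv : #|nbr_in e V v :\: C| = 0 by rewrite -def_C setDUr setDv setI0 cards0.
have inC u : u \in C -> u != v -> u \in nbr_in e V v.
  by rewrite -def_C in_setU1 => /predU1P [->|]; rewrite ?eqxx.
have outC u : u \in C -> 4 <= #|nbr_in e V u| -> #|nbr_in e V u :\: C| <= 1.
  have [->|uv uC du] := eqVneq u v; first by rewrite outv.
  have := card_out_le sym small vV (inC _ uC uv) _ du; rewrite def_C cC; lia.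
have outlow u : u \in C -> #|nbr_in e V u| <= 3 -> #|nbr_in e V u :\: C| <= 2.
  have [->|uv uC du] := eqVneq u v; first by rewrite outv.
  by rewrite -def_C card_out_le2 // inC.
(* Both cases delete [C] and one more vertex [x]. After [C] is gone, [x] costs twice the number of
   its neighbours outside [C]. *)
have finish x b : x \in V -> x \notin C ->
    \sum_(u in C) (#|nbr_in e V u| + #|nbr_in e V u :\: C|) <= b ->
    b + 2 * #|nbr_in e V x :\: C| <= (n - 1) * (n - 2) -> peelable e n V.
  move=> xV xC leb lebx; exists (C :|: [set x]); split.
  - by rewrite subUset sC sub1set.
  - by rewrite setUC cardsU1 xC cC; lia.
  rewrite (degree_sumD sym sC) (@degree_sumD1 _ e (V :\: C) x) // ?inE ?xV ?xC //.
  by rewrite setDDl nbr_inD; lia.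
(* A vertex of [C] can contribute as much as n-2 only if it has degree n-3 and a neighbour outside
   [C]. *)
have [/existsP [u /and3P [uC /eqP du /eqP outu]]|none] := boolP [exists u,
    [&& u \in C, #|nbr_in e V u| == n - 3 & #|nbr_in e V u :\: C| == 1]].
  have /cards1P [x defx] : #|nbr_in e V u :\: C| == 1 by apply/eqP.
  have [xC xu] : x \notin C /\ x \in nbr_in e V u.
    by apply/andP; rewrite -in_setD defx set11.
  have xV : x \in V by move: xu; rewrite inE => /andP [].
  have uV := subsetP sC _ uC.
  have uNx : u \in nbr_in e V x by rewrite inE uV sym; case/setIdP: xu.
  (* As [x] is the only neighbour of [u] outside [C], the neighbours of [x] outside [C] also avoid
     the closed neighbourhood of [u], to which [card_out_le] applies with [u] as centre. *)
  have outx : #|nbr_in e V x :\: C| <= 2.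
    have [dx|dx] := leqP 4 #|nbr_in e V x|.
      have := card_out_le sym small uV xu _ dx; rewrite card_closed_nbr // du.
      have /subset_leq_card : nbr_in e V x :\: C
          \subset nbr_in e V x :\: (u |: nbr_in e V u).
        apply/subsetP => w /setDP [wx wC]; rewrite in_setD wx andbT in_setU1.
        apply/norP; split; first by apply: contraNneq wC => ->.
        apply/negP => wu; have : w \in nbr_in e V u :\: C by rewrite in_setD wC.
        by rewrite defx => /set1P wx'; move: wx; rewrite wx' inE irr andbF.
      by lia.
    move: dx; rewrite (cardsD1 u) uNx add1n !ltnS; apply: leq_trans.
    by apply: subset_leq_card; apply: setDS; rewrite sub1set.
  apply: (finish x ((n - 2) * (n - 3) + (n - 3))) => //; last by nia.
  have vC : v \in C by rewrite -def_C setU11.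
  rewrite (big_setD1 v) //= outv dv addn0 addnC leq_add2r.
  have -> : (n - 2) * (n - 3) = #|C :\ v| * (n - 2).
    by rewrite mulnC; congr muln; move: cC; rewrite (cardsD1 v) vC; clear; lia.
  rewrite -sum_nat_const; apply: leq_sum => w /setD1P [wv wC].
  have := max _ (subsetP sC _ wC); have [dw|dw] := leqP 4 #|nbr_in e V w|.
    by have := outC _ wC dw; clear -n9; lia.
  by have := outlow _ wC dw; move: dw; clear -n9; lia.
have [x xV xC] : exists2 x, x \in V & x \notin C.
  apply/subsetPn; apply: contraL nV => /subset_leq_card; rewrite cC; lia.
(* Now every vertex of [C] contributes at most n-3. The slack 2(n-2) pays for any [x], whose degree
   is at most n-3. *)
apply: (finish x ((n - 2) * (n - 3))) => //.
  rewrite -cC -sum_nat_const; apply: leq_sum => w wC.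
  have dwle := max _ (subsetP sC _ wC).
  have [dw|dw] := leqP 4 #|nbr_in e V w|; last by have := outlow _ wC dw; lia.
  have := existsPn none w; rewrite wC /=; have := outC _ wC dw.
  by case: eqP => /=; [move=> _ + /eqP|]; lia.
have := subset_leq_card (subsetDl (nbr_in e V x) C); have := max _ xV; nia.
Qed.

Lemma peelable_degree_n4 (T : finType) (e : rel T) (n : nat) (V : {set T}) v u :
  9 <= n <= #|V| -> symmetric e -> irreflexive e -> small_unions e n -> v \in V ->
  #|nbr_in e V v| = n - 4 ->
  (forall u, u \in V -> #|nbr_in e V u| <= n - 4) ->
  u \in nbr_in e V v -> #|nbr_in e V u| = n - 4 ->
  ~~ (nbr_in e V u \subset v |: nbr_in e V v) -> peelable e n V.
Proof.
move=> /andP [n9 nV] sym irr small vV dv max uv du.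
move def_C: (v |: nbr_in e V v) => C /subsetPn [x xu xC].
have cC : #|C| = n - 3 by rewrite -def_C card_closed_nbr // dv; lia.
have sC : C \subset V.
  by rewrite -def_C subUset sub1set vV; apply/subsetP => w /setIdP [].
have vC : v \in C by rewrite -def_C setU11.
have uC : u \in C by rewrite -def_C in_setU1 uv orbT.
have uV := subsetP sC _ uC.
have outv : #|nbr_in e V v :\: C| = 0 by rewrite -def_C setDUr setDv setI0 cards0.
have out2 w : w \in C -> #|nbr_in e V w :\: C| <= 2.
  have [->|wv] := eqVneq w v; first by rewrite outv.
  rewrite -{1}def_C in_setU1 (negPf wv) /= => wC.
  have [dw|dw] := leqP 4 #|nbr_in e V w|; last by rewrite -def_C card_out_le2.
  by have := card_out_le sym small vV wC _ dw; rewrite def_C cC dv; clear -n9; lia.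
have xV : x \in V by case/setIdP: xu.
have uNx : u \in nbr_in e V x by rewrite inE uV sym; case/setIdP: xu.
(* For [x] of degree at least 4, a neighbour outside [C] is either outside the closed neighbourhood
   of [u] (at most two of these) or the one possible neighbour of [u] outside [C] other than [x]. *)
have outx : #|nbr_in e V x :\: C| <= 3.
  have [dx|dx] := leqP 4 #|nbr_in e V x|; last first.
    exact: leq_trans (subset_leq_card (subsetDl _ _)) _.
  have := card_out_le sym small uV xu _ dx; rewrite card_closed_nbr // du.
  have /subset_leq_card : nbr_in e V x :\: C \subset
      (nbr_in e V x :\: (u |: nbr_in e V u)) :|: ((nbr_in e V u :\: C) :\ x).
    apply/subsetP => w /setDP [wx wC].
    have w_ne_x : w != x by apply: contraTneq wx => ->; rewrite inE irr andbF.
    have w_ne_u : w != u by apply: contraNneq wC => ->.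
    rewrite in_setU !in_setD in_setU1 in_set1 wx wC w_ne_x (negPf w_ne_u) /=.
    by rewrite andbT orNb.
  have := (leq_card_setU (nbr_in e V x :\: (u |: nbr_in e V u))
             ((nbr_in e V u :\: C) :\ x)).1.
  have := out2 _ uC; rewrite (cardsD1 x) in_setD xC xu /=.
  by clear -n9; lia.
have [y yV yCx] : exists2 y, y \in V & y \notin x |: C.
  apply/subsetPn; apply: contraL nV => /subset_leq_card; rewrite cardsU1 xC cC.
  by clear -n9; lia.
exists ((C :|: [set x]) :|: [set y]); split.
- by rewrite !subUset sC !sub1set xV.
- by rewrite setUC (setUC C) !cardsU1 yCx xC cC; clear -n9; lia.
have yVCx : y \in V :\: C :\ x.
  by move: yCx; rewrite in_setU1 negb_or => /andP [yx yC]; rewrite !in_setD in_set1 yx yC.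
rewrite (degree_sumD sym sC) (@degree_sumD1 _ e (V :\: C) x) // ?inE ?xV ?xC //.
rewrite (@degree_sumD1 _ e (V :\: C :\ x) y) // !setDDl !nbr_inD.
have touchC : \sum_(w in C) (#|nbr_in e V w| + #|nbr_in e V w :\: C|)
    <= (n - 4) * (n - 1).
  rewrite (big_setD1 v) //= outv dv addn0.
  have -> : (n - 4) * (n - 1) = (n - 4) + #|C :\ v| * (n - 2).
    have -> : #|C :\ v| = n - 4 by move: cC; rewrite (cardsD1 v) vC; clear; lia.
    by rewrite -mulnS; congr muln; clear -n9; lia.
  rewrite leq_add2l -sum_nat_const; apply: leq_sum => w /setD1P [_ wC].
  by have := max _ (subsetP sC _ wC); have := out2 _ wC; clear -n9; lia.
have := max _ yV.
have := subset_leq_card (subsetDl (nbr_in e V y) (C :|: [set x])).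
(* The budget is used up exactly: (n-4)(n-1) for [C], 2(n-4) for [y] and 2 * 3 for [x]. *)
have : (n - 4) * (n - 1) + 2 * (n - 4) + 6 = (n - 1) * (n - 2).
  have [m def_n] : exists m, n = m + 4 by exists (n - 4); clear -n9; lia.
  have -> : n - 4 = m by rewrite def_n; clear; lia.
  have -> : n - 1 = m + 3 by rewrite def_n; clear; lia.
  have -> : n - 2 = m + 2 by rewrite def_n; clear; lia.
  by clear; lia.
rewrite setUA; move: touchC outx; clear; lia.
Qed.

(** * The remaining case k = 1, and the induction on k *)

(** In the closed neighbourhood [C] of [v], vertices of degree n-4 send no edge out, and the others
    have degree at most n-5 and at most two neighbours outside, so each contributes at most n-3. The
    r+2 vertices outside [C] span at most a complete graph. *)
Lemma degree_sum_n4_le (T : finType) (e : rel T) (n r : nat) (V : {set T}) v :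
  15 <= n -> 3 <= r <= n - 9 -> #|V| = n - 1 + r ->
  symmetric e -> irreflexive e -> small_unions e n -> v \in V ->
  #|nbr_in e V v| = n - 4 ->
  (forall u, u \in V -> #|nbr_in e V u| <= n - 4) ->
  (forall u, u \in nbr_in e V v -> #|nbr_in e V u| = n - 4 ->
     nbr_in e V u \subset v |: nbr_in e V v) ->
  degree_sum e V <= (n - 5) * (n - 1 + r).
Proof.
move=> n15 /andP [r3 rn] cV sym irr small vV dv max.
move def_C: (v |: nbr_in e V v) => C closedC.
have cC : #|C| = n - 3 by rewrite -def_C card_closed_nbr // dv; lia.
have sC : C \subset V.
  by rewrite -def_C subUset sub1set vV; apply/subsetP => w /setIdP [].
have touchC : \sum_(w in C) (#|nbr_in e V w| + #|nbr_in e V w :\: C|)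
    <= (n - 3) * (n - 3).
  rewrite -{1}cC -sum_nat_const; apply: leq_sum => w.
  have [->|wv] := eqVneq w v.
    by rewrite -def_C setDUr setDv setI0 cards0 dv; lia.
  move=> wC; have dw := max _ (subsetP sC _ wC).
  move: wC; rewrite -{1}def_C in_setU1 (negPf wv) /= => wC.
  have [dw4|dw4] := eqVneq #|nbr_in e V w| (n - 4).
    by have := closedC _ wC dw4; rewrite -setD_eq0 => /eqP ->; rewrite cards0; lia.
  have [dw3|dw3] := leqP 4 #|nbr_in e V w|.
    by have := card_out_le sym small vV wC _ dw3; rewrite def_C cC; lia.
  by have := card_out_le2 sym vV wC dw3; rewrite def_C; lia.
have cVC : #|V :\: C| = r + 2 by rewrite cardsD (setIidPr sC); lia.
have : degree_sum e (V :\: C) <= #|V :\: C| * (#|V :\: C| - 1).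
  by apply: degree_sum_le => w /(card_nbr_in_le irr).
rewrite (degree_sumD sym sC) cVC.
(* With r = q+3 and n = q+12+s, the right side minus the left is qs + q + 3s - 3. It is nonnegative
   because 15 <= n gives q+s >= 3. *)
have : (r + 2) * (r + 2 - 1) + (n - 3) * (n - 3) <= (n - 5) * (n - 1 + r).
  have [q def_r] : exists q, r = q + 3 by exists (r - 3); lia.
  have [s def_n] : exists s, n = q + 12 + s by exists (n - (r + 9)); lia.
  have -> : n - 3 = q + 9 + s by lia.
  have -> : n - 5 = q + 7 + s by lia.
  have -> : n - 1 + r = q + q + 14 + s by lia.
  have -> : r + 2 - 1 = q + 4 by lia.
  have : 0 <= q * s by [].
  by rewrite def_r; lia.
lia.
Qed.

(** The alternatives are the degree sums of the two extremal graphs, the second up to parity.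
    Peeling keeps r and adds one clique to either alternative; [0 < k] makes the truncated [k - 1] a
    true difference. *)
Lemma degree_sum_small_unions (T : finType) (e : rel T) (n r k : nat) (V : {set T}) :
  15 <= n -> 3 <= r <= n - 9 -> #|V| = k * (n - 1) + r ->
  symmetric e -> irreflexive e -> small_unions e n ->
  degree_sum e V <= k * ((n - 1) * (n - 2)) + r * (r - 1) \/
  0 < k /\ degree_sum e V <=
             (k - 1) * ((n - 1) * (n - 2)) + (n - 5) * (n - 1 + r).
Proof.
move=> n15 r39 + sym irr small; elim: k V => [|k IHk] V cV.
  left; rewrite mul0n add0n.
  have -> : r = #|V| by rewrite cV.
  by apply: degree_sum_le => w /(card_nbr_in_le irr).
have peel : peelable e n V -> degree_sum e V <= k.+1 * ((n - 1) * (n - 2)) + r * (r - 1)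
    \/ 0 < k.+1 /\ degree_sum e V <=
         (k.+1 - 1) * ((n - 1) * (n - 2)) + (n - 5) * (n - 1 + r).
  case=> S [sS cS leS].
  have [|bound|[k0 bound]] := IHk (V :\: S).
  - by rewrite cardsD (setIidPr sS) cV cS mulSn -addnA addKn.
  - left; rewrite mulSn -addnA [leqRHS]addnC; apply: leq_trans leS _.
    by rewrite leq_add2r.
  right; split=> //; rewrite subSS subn0; apply: leq_trans leS _.
  case: k k0 bound {IHk cV} => // k _; rewrite subSS subn0 => bound.
  by rewrite mulSn -addnA [leqRHS]addnC leq_add2r.
have sparse d : (forall u, u \in V -> #|nbr_in e V u| <= d) ->
    (k.+1 * (n - 1) + r) * d <= k * ((n - 1) * (n - 2)) + (n - 5) * (n - 1 + r) ->
    0 < k.+1 /\ degree_sum e V <=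
         (k.+1 - 1) * ((n - 1) * (n - 2)) + (n - 5) * (n - 1 + r).
  move=> deg led; split=> //; rewrite subSS subn0; apply: leq_trans led.
  by rewrite -cV; apply: degree_sum_le.
have nV : n <= #|V| by rewrite cV mulSn; lia.
have [v0 v0V] : exists v, v \in V by apply/card_gt0P; lia.
case: (@arg_maxnP _ v0 (mem V) (fun v => #|nbr_in e V v|) v0V) => v vV maxv.
have [dv|dv] := leqP #|nbr_in e V v| (n - 5).
  right; apply: (sparse (n - 5)) => [u /maxv /leq_trans|]; first exact.
  have : k * (n - 1) * (n - 5) <= k * ((n - 1) * (n - 2)).
    by rewrite -mulnA leq_mul2l leq_mul2l leq_sub2l ?orbT.
  by rewrite mulSn; nia.
have [dv1|dv1] := leqP (n - 1) #|nbr_in e V v|.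
  by apply/peel/(@peelable_big_degree _ e n V v); rewrite //; lia.
have [dv2|dv2] := eqVneq #|nbr_in e V v| (n - 2).
  apply/peel/(@peelable_degree_n2 _ e n V v); rewrite ?dv2 //; first by lia.
  by rewrite -dv2; apply: maxv.
have [dv3|dv3] := eqVneq #|nbr_in e V v| (n - 3).
  apply/peel/(@peelable_degree_n3 _ e n V v); rewrite ?dv3 ?nV ?andbT //; first by lia.
  by rewrite -dv3; apply: maxv.
have dv4 : #|nbr_in e V v| = n - 4 by lia.
rewrite dv4 in maxv.
case: k IHk cV peel sparse => [|k] IHk cV peel sparse; last first.
  (* Against the bound, degree n-4 loses 1 on each of n-1+r vertices but gains 2 on each vertex of
     at least one further block of n-1, and r <= n-1. *)
  right; apply: (sparse (n - 4)) => //.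
  have [m def_n] : exists m, n = m + 5 by exists (n - 5); clear -n15; lia.
  have -> : n - 5 = m by rewrite def_n; clear; lia.
  have -> : n - 4 = m + 1 by rewrite def_n; clear; lia.
  have -> : n - 2 = m + 3 by rewrite def_n; clear; lia.
  have lerm : r <= m + 4 by move: r39; clear -def_n; lia.
  have -> : n - 1 = m + 4 by rewrite def_n; clear; lia.
  by rewrite !mulSn !mulnDl; move: lerm; clear; lia.
have [/exists_inP [u uv /andP [/eqP du outu]]|none] := boolP [exists u in nbr_in e V v,
    (#|nbr_in e V u| == n - 4) && ~~ (nbr_in e V u \subset v |: nbr_in e V v)].
  by apply/peel/(@peelable_degree_n4 _ e n V v u); rewrite ?nV ?andbT //; lia.
right; split=> //; rewrite mul0n add0n.
apply: (@degree_sum_n4_le _ e n r V v) => //; first by rewrite cV mul1n.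
move=> u uv du; have := exists_inPn none u uv.
by rewrite du eqxx /= negbK.
Qed.

(** * Lower-bound constructions *)

(** No vertex can serve as v_0: either it has fewer than the n-4 neighbours required, or it lies in
    a union of components with fewer than n vertices, which would have to contain the whole
    connected tree. *)
Lemma degree_sum_le_ex (T : finType) (e : rel T) (n : nat) :
  6 <= n -> symmetric e -> irreflexive e ->
  (forall v, #|nbr_in e setT v| < n - 4 \/
     exists K : {set T}, [/\ v \in K, #|K| < n &
       forall x y, x \in K -> e x y -> y \in K]) ->
  degree_sum e setT <= (ex #|T| (Tn3 n)).*2.
Proof.
move=> n6 sym irr sparse.
pose E := [set A : {set 'I_#|T|} | (#|A| == 2) &&
  [forall i in A, forall j in A, (i != j) ==> e (enum_val i) (enum_val j)]].
have inE_E i j : ([set i; j] \in E) = e (enum_val i) (enum_val j).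
  rewrite inE cards2; have [->|ij] /= := eqVneq i j; first by rewrite irr.
  apply/forall_inP/idP => [/(_ i)|eij x].
    by rewrite !inE eqxx => /(_ isT)/forall_inP/(_ j); rewrite !inE eqxx orbT ij; apply.
  move=> xij; apply/forall_inP => y yij; apply/implyP.
  case/set2P: xij => ->; case/set2P: yij => ->; rewrite ?eqxx // => _.
  by rewrite sym.
have simE : simple_graph E by apply/forall_inP => A; rewrite inE => /andP [].
clearbody E; have -> : degree_sum e setT = #|E|.*2.
  rewrite -sum_degrees_edges // degree_sumT.
  rewrite [RHS](reindex (@enum_rank T)) /=; last exact/onW_bij/enum_rank_bij.
  apply: eq_bigr => v _.
  rewrite -(card_imset _ enum_rank_inj); apply: eq_card => i.
  rewrite -[i]enum_valK mem_imset; last exact: enum_rank_inj.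
  by rewrite !inE inE_E !enum_rankK.
rewrite leq_double; apply: (@leq_bigmax_cond _ _ (fun E : {set {set 'I_#|T|}} => #|E|) E).
rewrite simE /=; apply/existsP => -[f /andP [/injectiveP injf /forallP fE]].
pose g i := enum_val (f i).
have injg : injective g by move=> i j /enum_val_inj /injf.
have edge i j : Tn3 n i j -> e (g i) (g j).
  by rewrite -inE_E; move/(_ i)/forallP/(_ j): fE => /implyP.
have n_gt0 : 0 < n by lia.
have n_gt1 : 1 < n by lia.
pose i0 := Ordinal n_gt0; pose i1 := Ordinal n_gt1.
have edge0 (i : 'I_n) : 0 < i <= n - 4 -> e (g i0) (g i).
  by move=> i_bd; apply: edge; rewrite /Tn3 /T3edge /= i_bd.
have [|[K [gK cK closedK]]] := sparse (g i0).
  rewrite ltnNge => /negP; apply.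
  have lt_succ (i : 'I_(n - 4)) : i.+1 < n by have := ltn_ord i; lia.
  have injS : injective (fun i => g (Ordinal (lt_succ i))).
    by move=> i j /injg /(congr1 val) [] /val_inj.
  rewrite -[leqLHS]card_ord -cardsT -(card_imset _ injS); apply: subset_leq_card.
  apply/subsetP => _ /imsetP [i _ ->]; rewrite !inE; apply: edge0 => /=.
  exact: ltn_ord.
have allK i : g i \in K.
  have [i_small|i_big] := leqP i (n - 4).
    have [i_0|i_pos] := posnP i; first by rewrite (_ : i = i0) //; apply: val_inj.
    by apply: closedK gK (edge0 i _); rewrite i_pos.
  apply: (closedK (g i1)); first by apply: closedK gK (edge0 i1 _) => /=; lia.
  by apply: edge; apply/orP; left; rewrite /T3edge /=; lia.
have : #|[set g i | i in setT]| <= #|K|.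
  by apply: subset_leq_card; apply/subsetP => _ /imsetP [i _ ->].
by rewrite card_imset // cardsT card_ord leqNgt cK.
Qed.

Definition cliques_plus (c m : nat) (U : finType) (h : rel U) : rel ('I_c * 'I_m + U) :=
  fun x y => match x, y with
  | inl a, inl b => (a.1 == b.1) && (a.2 != b.2)
  | inr a, inr b => h a b
  | _, _ => false
  end.

(** A copy of K_{n-1} is too small to hold the tree; the part [h] is excluded by its degrees or by
    its size. *)
Lemma cliques_plus_le_ex (c n : nat) (U : finType) (h : rel U) :
  6 <= n -> symmetric h -> irreflexive h ->
  (forall v, #|nbr_in h setT v| < n - 4) \/ #|U| < n ->
  c * ((n - 1) * (n - 2)) + degree_sum h setT <=
    (ex (c * (n - 1) + #|U|) (Tn3 n)).*2.
Proof.
move=> n6 symh irrh sparse; pose e := @cliques_plus c (n - 1) U h.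
have cT : #|{: 'I_c * 'I_(n - 1) + U}| = c * (n - 1) + #|U|.
  by rewrite card_sum card_prod !card_ord.
have nbr_l a : nbr_in e setT (inl a) = [set inl (a.1, j) | j in [set~ a.2]].
  apply/setP => -[[b1 b2]|b]; rewrite !inE /=.
    apply/andP/imsetP => [[/eqP <- ab2]|[j]]; first by exists b2; rewrite ?inE // eq_sym.
    by rewrite !inE => ja [-> ->]; rewrite eqxx eq_sym.
  by apply/esym/imsetP => -[].
have nbr_r u : nbr_in e setT (inr u) = [set inr w | w in nbr_in h setT u].
  apply/setP => -[b|w]; rewrite !inE /=; first by apply/esym/imsetP => -[].
  by rewrite mem_imset ?inE // => w1 w2 [].
have dl a : #|nbr_in e setT (inl a)| = n - 2.
  by rewrite nbr_l card_imset ?cardsC1 ?card_ord; [lia|move=> j1 j2 []].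
have dr u : #|nbr_in e setT (inr u)| = #|nbr_in h setT u|.
  by rewrite nbr_r card_imset // => w1 w2 [].
have <- : degree_sum e setT = c * ((n - 1) * (n - 2)) + degree_sum h setT.
  rewrite !degree_sumT big_sumType /=; congr addn; last exact: eq_bigr.
  rewrite (eq_bigr _ (fun a _ => dl a)) sum_nat_const card_prod !card_ord.
  by rewrite mulnA.
rewrite -cT; apply: degree_sum_le_ex => //.
- move=> [a|a] [b|b]; rewrite /e //=.
  by rewrite (eq_sym a.1) (eq_sym a.2).
- by move=> [a|a] /=; rewrite ?irrh ?eqxx ?andbF.
case=> [a|u]; last first.
  case: sparse => [degh|cU]; [left|right]; first by rewrite dr.
  exists [set inr w | w in [set: U]]; split.
  - by rewrite imset_f.
  - by rewrite card_imset ?cardsT // => w1 w2 [].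
  by move=> _ [y|w] /imsetP [w' _ ->] // _; rewrite imset_f.
right; exists [set inl (a.1, j) | j in [set: 'I_(n - 1)]]; split.
- by apply/imsetP; exists a.2; rewrite -?surjective_pairing.
- by rewrite card_imset ?cardsT ?card_ord; [lia|move=> j1 j2 []].
by move=> _ [[y1 y2]|w] /imsetP [j _ ->] //= /andP [/eqP <- _]; rewrite imset_f.
Qed.

Lemma near_regular_graph (m d : nat) : d + 2 <= m ->
  exists h : rel 'I_m, [/\ symmetric h, irreflexive h,
    forall v, #|nbr_in h setT v| <= d & m * d <= degree_sum h setT + 1].
Proof.
case: m => [|m]; first by lia.
(* The circulant graph with distances 1, ..., d/2; for odd d, also join x to x + q
   for x < q, a matching which misses at most the vertex m. *)
move=> dm; pose q := m.+1./2; pose b := d./2.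
have bq : b < q by rewrite /b /q; lia.
pose D1 := [set a : 'I_m.+1 | 0 < a <= b].
pose D := [set a : 'I_m.+1 | (a \in D1) || (- a \in D1)%R].
have valN (a : 'I_m.+1) : 0 < a -> (- a)%R = m.+1 - a :> nat.
  by move=> a0; rewrite /= modn_small //; lia.
have cD1 : #|D1| = b.
  have lt_succ (i : 'I_b) : i.+1 < m.+1 by have := ltn_ord i; lia.
  have injS : injective (fun i => Ordinal (lt_succ i)).
    by move=> i j /(congr1 val) [] /val_inj.
  rewrite -[RHS]card_ord -cardsT -(card_imset _ injS); apply: eq_card => a.
  rewrite inE; apply/idP/imsetP => [a_bd|[i _ ->]] /=; last exact: ltn_ord.
  have a_lt : a.-1 < b by lia.
  by exists (Ordinal a_lt) => //; apply: val_inj => /=; lia.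
(* Since 2b < m+1, [D1] does not meet its negative. *)
have cD : #|D| = b.*2.
  have -> : D = D1 :|: [set (- a)%R | a in D1].
    apply/setP => a; rewrite in_setU /D in_set; congr (_ || _).
    by rewrite -{2}[a]opprK mem_imset //; apply: oppr_inj.
  rewrite cardsU card_imset; last exact: oppr_inj.
  rewrite cD1 disjoint_setI0 ?cards0 ?subn0 ?addnn //.
  rewrite disjoint_subset; apply/subsetP => a; rewrite inE => a_bd.
  rewrite inE; apply/imsetP => -[a']; rewrite inE => a'_bd def_a.
  move: a_bd; rewrite def_a valN; last by case/andP: a'_bd.
  by move: dm a'_bd bq; rewrite /q; lia.
pose M (x y : 'I_m.+1) := (x < q) && (y == x + q :> nat).
pose mate x y := odd d && (M x y || M y x).
pose h x y := ((y - x)%R \in D) || mate x y.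
pose NM x := [set y | mate x y].
have nbr_h x : nbr_in h setT x = [set (a + x)%R | a in D] :|: NM x.
  apply/setP => y; rewrite in_set in_setT in_setU [y \in NM x]in_set.
  congr (_ || _); rewrite -{2}[y](subrK x) (mem_imset (f := fun a => (a + x)%R)) //.
  exact: addIr.
have M_val x y : M x y -> (y - x)%R = q :> nat.
  case/andP => xq /eqP y_xq.
  have q_m : q < m.+1 by rewrite /q; lia.
  have -> : y = (inord q + x)%R.
    apply: val_inj; rewrite /= inordK // modn_small; first by rewrite addnC.
    by rewrite addnC -y_xq.
  by rewrite addrK inordK.
(* Both q and m+1-q exceed b, so the matching shares no edge with the circulant graph. *)
have qD (a : 'I_m.+1) : a = q :> nat -> a \notin D.
  move=> a_q; rewrite !inE valN a_q; last by lia.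
  by apply/negP; move: bq; rewrite /q; lia.
have DN a : (- a \in D)%R = (a \in D) by rewrite !inE opprK orbC.
have disj x : [set (a + x)%R | a in D] :&: NM x = set0.
  apply/setP => y; rewrite !inE; apply/negP => /andP [/imsetP [a aD ->]].
  case/andP => _ /orP [] /M_val /qD; first by rewrite addrK aD.
  by rewrite opprD addrCA subrr addr0 DN aD.
have deg x : #|nbr_in h setT x| = b.*2 + #|NM x|.
  by rewrite nbr_h cardsU disj cards0 subn0 card_imset ?cD //; apply: addIr.
have cNM x : #|NM x| <= odd d.
  rewrite /NM /mate; case: (odd d) => /=; last first.
    by rewrite leqn0 cards_eq0; apply/eqP/setP => y; rewrite !inE.
  rewrite -(cards1 (inord (if x < q then x + q else x - q) : 'I_m.+1)).
  apply/subset_leq_card/subsetP => y; rewrite !inE /M => xy.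
  apply/eqP/val_inj; rewrite /= inordK; first by case: (ltnP x q) xy; lia.
  by have := ltn_ord x; case: (ltnP x q); rewrite /q; lia.
have cNM' x : odd d <= #|NM x| + (x == ord_max).
  rewrite /NM /mate; case: (odd d) => //=.
  have [//|x_max] := eqVneq x ord_max; rewrite ?addn1 // addn0.
  have x_m : x < m by rewrite ltn_neqAle -ltnS ltn_ord andbT -val_eqE in x_max *.
  apply/card_gt0P; exists (inord (if x < q then x + q else x - q)).
  rewrite !inE /M inordK; first by case: (ltnP x q); rewrite /q; lia.
  by case: (ltnP x q); rewrite /q; lia.
exists h; split.
- move=> x y; rewrite /h /mate orbC [in RHS]orbC [M y x || _]orbC; congr (_ || _).
  by rewrite !inE opprB orbC -opprB opprK opprB.
- move=> x; rewrite /h /mate /M !inE subrr oppr0 /=; lia.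
- by move=> x; rewrite deg -[leqRHS]odd_double_half addnC leq_add2r.
have -> : m.+1 * d = \sum_(x : 'I_m.+1) d by rewrite sum_nat_const card_ord.
have <- : \sum_(x : 'I_m.+1) (x == ord_max) = 1.
  by rewrite (bigD1 ord_max) //= eqxx big1 // => x /negPf ->.
rewrite degree_sumT -big_split /=; apply: leq_sum => x _.
by rewrite deg -addnA -{1}[d]odd_double_half addnC leq_add2l.
Qed.

(** * The bounds for [ex], and the closed formula *)

Lemma ex_Tn3_le (n r k : nat) : 15 <= n -> 3 <= r <= n - 9 ->
  (ex (k * (n - 1) + r) (Tn3 n)).*2 <= k * ((n - 1) * (n - 2)) + r * (r - 1) \/
  0 < k /\ (ex (k * (n - 1) + r) (Tn3 n)).*2 <=
             (k - 1) * ((n - 1) * (n - 2)) + (n - 5) * (n - 1 + r).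
Proof.
move=> n15 r39; pose free (E : {set {set 'I_(k * (n - 1) + r)}}) :=
  simple_graph E && ~~ contains_sub (Tn3 n) E.
have [E /andP [simE freeE]|no_free] := pickP free; last first.
  (* Without an admissible edge set the maximum takes its default value 0. *)
  by left; rewrite /ex big_pred0.
rewrite /ex (bigop.bigmax_eq_arg E) ?simE //.
case: arg_maxnP => [|{freeE}{}E /andP [{}simE freeE] _]; first by rewrite simE.
pose e i j := [set i; j] \in E.
have nbrT v : nbr_in e setT v = [set w | [set v; w] \in E].
  by apply/setP => w; rewrite !inE.
have <- : degree_sum e setT = #|E|.*2.
  rewrite -sum_degrees_edges // degree_sumT.
  by apply: eq_bigr => v _; rewrite nbrT.
have sub V v : nbr_in e V v \subset nbr_in e setT v.
  by apply/subsetP => w; rewrite !inE => /andP [].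
apply: degree_sum_small_unions => //; first by rewrite cardsT card_ord.
- by move=> i j; rewrite /e setUC.
- move=> i; apply/negP => ii; move/forall_inP: simE => /(_ _ ii).
  by rewrite setUid cards1.
move=> V v u; rewrite inE => /andP [_ vu] dv du.
(* Restricting to [V] only shrinks neighbourhoods, so the degree hypotheses pass up to the whole
   graph and the bound on the union passes down. *)
apply: leq_trans (subset_leq_card (setUSS (sub V v) (sub V u))) _.
rewrite !nbrT; apply: union_nbr_Tn3_free => //; first by lia.
  by rewrite -nbrT; apply: leq_trans dv (subset_leq_card (sub V v)).
by rewrite -nbrT; apply: leq_trans du (subset_leq_card (sub V u)).
Qed.

Lemma ex_Tn3_ge_cliques (n r k : nat) : 6 <= n -> r < n ->
  k * ((n - 1) * (n - 2)) + r * (r - 1) <= (ex (k * (n - 1) + r) (Tn3 n)).*2.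
Proof.
move=> n6 rn; pose h (i j : 'I_r) := i != j.
have -> : r * (r - 1) = degree_sum h setT.
  rewrite degree_sumT (eq_bigr (fun=> r - 1)) ?sum_nat_const ?card_ord //.
  move=> i _; rewrite -[r in r - 1]card_ord subn1 -(cardsC1 i).
  by apply: eq_card => j; rewrite !inE eq_sym.
rewrite -[r in leqRHS]card_ord; apply: cliques_plus_le_ex => //.
- by move=> i j; rewrite /h eq_sym.
- by move=> i; rewrite /h eqxx.
by right; rewrite card_ord.
Qed.

(** The [+ 1] accounts for parity: (n-5)(n-1+r) may be odd, and then no graph on n-1+r vertices is
    regular of degree n-5. *)
Lemma ex_Tn3_ge_near_regular (n r k : nat) : 6 <= n -> 0 < k ->
  (k - 1) * ((n - 1) * (n - 2)) + (n - 5) * (n - 1 + r) <=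
    (ex (k * (n - 1) + r) (Tn3 n)).*2 + 1.
Proof.
move=> n6; case: k => // k _.
have [|h [symh irrh degh edgesh]] := @near_regular_graph (n - 1 + r) (n - 5).
  by lia.
have := @cliques_plus_le_ex k n _ h n6 symh irrh.
rewrite card_ord addnA -mulSnr subSS subn0 => le_ex.
rewrite mulnC in edgesh.
apply: leq_trans (_ : k * ((n - 1) * (n - 2)) + (degree_sum h setT + 1) <= _).
  by rewrite leq_add2l.
rewrite addnA leq_add2r; apply: le_ex; left=> v.
by apply: leq_ltn_trans (degh v) _; lia.
Qed.

Theorem theorem4p2 (p n k r : nat) :
  15 <= n -> n <= p -> 0 < k -> 3 <= r -> r <= n - 9 ->
  p = k * (n - 1) + r ->
  ((ex p (Tn3 n))%:R : rat) =
    (((n - 2) * p - r * (n - 1 - r))%:R / 2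
     + (Num.max 0%R (((r * (n - 4 - r))%:Z - (3 * (n - 1))%:Z) %/ 2)%Z)%:~R)%R.
Proof.
move=> n15 _ k0 r3 rn def_p.
have r39 : 3 <= r <= n - 9 by rewrite r3.
have upper := ex_Tn3_le k n15 r39.
have lower1 : k * ((n - 1) * (n - 2)) + r * (r - 1) <= (ex (k * (n - 1) + r) (Tn3 n)).*2.
  by apply: ex_Tn3_ge_cliques; lia.
have lower2 : (k - 1) * ((n - 1) * (n - 2)) + (n - 5) * (n - 1 + r) <=
    (ex (k * (n - 1) + r) (Tn3 n)).*2 + 1.
  by apply: ex_Tn3_ge_near_regular; lia.
rewrite -def_p in upper lower1 lower2.
move: (ex p (Tn3 n)) upper lower1 lower2 => x upper lower1 lower2.
(* The number of edges of k K_{n-1} + K_r, which is the first term of the formula. *)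
pose a := k * 'C(n - 1, 2) + 'C(r, 2).
have double_a : k * ((n - 1) * (n - 2)) + r * (r - 1) = a.*2.
  rewrite /a -mul2n mulnDr (mulnCA 2) -!mul_bin_diag !bin1 !subn1.
  by rewrite subn2.
have -> : (n - 2) * p - r * (n - 1 - r) = a.*2.
  rewrite -double_a def_p mulnDr.
  have {2}-> : n - 2 = (r - 1) + (n - 1 - r) by clear -r3 rn; lia.
  by rewrite [r * (_ - r)]mulnC mulnDl addnA addnK; nia.
(* The second candidate exceeds the first by the numerator inside the floor, taken over the integers
   since it may be negative. *)
have diff : (((k - 1) * ((n - 1) * (n - 2)) + (n - 5) * (n - 1 + r))%:Z =
    a.*2%:Z + ((r * (n - 4 - r))%:Z - (3 * (n - 1))%:Z))%R.
  have : (k - 1) * ((n - 1) * (n - 2)) + (n - 5) * (n - 1 + r) + 3 * (n - 1) =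
      a.*2 + r * (n - 4 - r).
    rewrite -double_a; case: k k0 {def_p a double_a upper lower1 lower2} => // k _.
    have [s def_n] : exists s, n = r + 9 + s by exists (n - (r + 9)); clear -r3 rn; lia.
    have [q def_r] : exists q, r = q + 1 by exists (r - 1); clear -r3; lia.
    have -> : n - 5 = r + 4 + s by rewrite def_n; clear; lia.
    have -> : n - 4 - r = 5 + s by rewrite def_n; clear; lia.
    have -> : n - 2 = r + 7 + s by rewrite def_n; clear; lia.
    have -> : n - 1 = r + 8 + s by rewrite def_n; clear; lia.
    have -> : r - 1 = q by rewrite def_r; clear; lia.
    by rewrite subSS subn0 mulSn def_r; clear; lia.
  by clear; lia.
rewrite double_a in upper lower1.
move: diff upper lower1 lower2.
move: (_ + (n - 5) * _) (_ - _)%R => b z diff upper lower1 lower2.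
(* With [b] = 2a + z, the bounds say that 2x is at most 2a or at most 2a + z, while 2x >= 2a and 2x
   + 1 >= 2a + z. The last inequality means that x is at least a plus the floor of z/2. *)
have -> : (Num.max 0 (z %/ 2)%Z = x%:Z - a%:Z)%R.
  by clear - diff upper lower1 lower2; lia.
rewrite rmorphB /= -!pmulrn -muln2 natrM mulfK ?pnatr_eq0 //.
by rewrite addrC subrK.
Qed.
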